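(* Let $c>0$, $1\le\alpha\le2$, let $t\ge 1$ be an integer, and let $X_1,\dots,X_t$ be independent, identically distributed symmetric stable random variables with characteristic function $\varphi_{X_i}(u)=e^{-c|u|^{\alpha}}$ for every $i\in\{1,\dots,t\}$. Then the sum $S_t=X_1+\cdots+X_t$ has characteristic function $\varphi_{S_t}(u)=e^{-tc|u|^{\alpha}}$, and its characteristic curvature satisfies $$\Phi(tc;\alpha)=\Phi(c;\alpha)\,t^{\frac{1}{\alpha}}.$$
   Context: The characteristic function of a real random variable $X$ is $\varphi_X(u)=\mathbb{E}(e^{iuX})$. The characteristic curvature of a probability distribution symmetric around zero with characteristic function $\varphi_X$ is $$\Phi=\frac{2}{\sqrt{2\pi}}\int_{0}^{\infty}\Big(-\frac{\partial^2\ln\varphi_X(u)}{\partial u^2}\Big)\varphi_X(u)\,du,$$ where $\varphi_X$ is considered on $u\ge 0$. For the symmetric stable distribution with characteristic function $e^{-c|u|^{\alpha}}$ the characteristic curvature is denoted $\Phi(c;\alpha)$. *)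

(* Defs.v *)
(* MathComp-Analysis *)
From HB Require Import structures.
From mathcomp Require Import all_boot all_order all_algebra.
From mathcomp Require Import all_classical all_reals all_analysis.
From mathcomp Require Import complex.

Set Implicit Arguments.
Unset Strict Implicit.
Unset Printing Implicit Defensive.

Import Order.TTheory GRing.Theory Num.Theory.
Import numFieldNormedType.Exports.

Local Open Scope classical_set_scope.
Local Open Scope ring_scope.
Local Open Scope complex_scope.

(* For a random variable [X], [u |-> E(e^{iuX})], with
   [e^{iux} = cos(ux) + i sin(ux)]; both expectations are finite because the
   integrands are bounded, so [fine] loses nothing. *)
Definition char_fun (d : measure_display) (T : measurableType d)
    (R : realType) (P : probability T R) (X : T -> R) (u : R) : R[i] :=
  fine 'E_P[fun w => cos (u * X w)] +i* fine 'E_P[fun w => sin (u * X w)].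

Definition mutually_independent (d : measure_display) (T : measurableType d)
    (R : realType) (P : probability T R) (I : finType)
    (X : I -> {RV P >-> R}) : Prop :=
  forall (J : {set I}) (B : I -> set R), (forall i, measurable (B i)) ->
    P (\bigcap_(i in [set` J]) X i @^-1` B i) =
    (\prod_(i in J) P (X i @^-1` B i))%E.

(* Stated on measurable sets only: the values of the pushforward measure
   elsewhere carry no meaning. *)
Definition identically_distributed (d : measure_display)
    (T : measurableType d) (R : realType) (P : probability T R) (I : Type)
    (X : I -> {RV P >-> R}) : Prop :=
  forall (i j : I) (B : set R), measurable B ->
    distribution P (X i) B = distribution P (X j) B.

(* The characteristic curvature of a distribution symmetric around zero, as a
   function of its characteristic function [phi].  Symmetry makes [phi]
   real-valued, hence the real part.  The integral is the Lebesgue integral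
   with values in the extended reals; leaving out the single point [u = 0]
   ensures that [phi] is only differentiated at points [u > 0], as [phi] may
   have a kink at the origin. *)
Definition char_curvature (R : realType) (phi : R -> R[i]) : \bar R :=
  ((2 / Num.sqrt (2 * pi))%:E *
   \int[lebesgue_measure]_(u in `]0%R, +oo[)
     (- derive1n 2 (fun v : R => ln (complex.Re (phi v))) u
        * complex.Re (phi u))%:E)%E.

Definition stable_char_fun (R : realType) (c alpha : R) (u : R) : R[i] :=
  (expR (- (c * `|u| `^ alpha)))%:C.

Definition Phi (R : realType) (c alpha : R) : \bar R :=
  char_curvature (stable_char_fun c alpha).

(* Main.v *)
Require Import Defs.
From mathcomp Require Import all_boot all_order all_algebra.
From mathcomp Require Import all_classical all_reals all_analysis.
From mathcomp Require Import complex measurable_realfun ring lra.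

Set Implicit Arguments.
Unset Strict Implicit.
Unset Printing Implicit Defensive.

Import Order.TTheory GRing.Theory Num.Theory.
Import numFieldNormedType.Exports.

Local Open Scope ring_scope.

(** The proof has two independent halves.

    Probability: the characteristic function of a sum of independent variables
    is the product of the characteristic functions ([char_fun_sum]), so the
    sum of [t] copies has characteristic function
    [(e^{-c|u|^alpha})^t = e^{-tc|u|^alpha}].  Independence is a statement
    about events, so it has to be lifted to the bounded functions [cos] and
    [sin].  This is done one variable at a time: the induction hypothesis
    describes [cos (u S)] and [sin (u S)], for a partial sum [S], integrated
    over every event [{X_i in B_i for all i}] that does not constrain the
    variables already summed.  Letting [B_k] vary over all Borel sets
    identifies the signed measure [B |-> E(1_A cos (u S); X_k in B)] as a
    multiple of the law of [X_k], and [Rintegral_weight_comp] turns this into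
    the integral against any bounded function of [X_k].

    Analysis: for [u > 0] one has [ln phi (u) = - c u^alpha], so up to the
    factor [2 / sqrt (2 pi)] the curvature is the integral over [u > 0] of
    [h_c(u) = c alpha (alpha - 1) u^(alpha - 2) e^{-c u^alpha}] ([PhiE]).
    With [s = r^(1/alpha)] this density satisfies [h_{rc}(u) = s^2 h_c(s u)],
    and the substitution [v = s u] gives the factor [s] ([Phi_scale]).
    The integral is finite ([Phi_fin_num]): the density has an integrable
    singularity at [0] and decays at infinity, and both facts follow at once
    from a bound by a multiple of the derivative of the bounded function
    [y |-> 1 - 1 / (1 + y^(alpha - 1))]. *)

(** * Integrals of functions of one random variable against a weight *)

Section weights.
Local Open Scope classical_set_scope.
Import HBNNSimple.

Lemma ge0_integral_weight_nnsfun d d' (T : measurableType d)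
    (T' : measurableType d') (R : realType) (mu : {measure set T -> \bar R})
    (W : T -> R) (Y : T -> T') (h : {nnsfun T' >-> R}) :
  measurable_fun setT W -> measurable_fun setT Y -> (forall x, 0 <= W x) ->
  (\int[mu]_x (W x * h (Y x))%:E = \sum_(r \in range h)
    r%:E * \int[mu]_(x in Y @^-1` (h @^-1` [set r])) (W x)%:E)%E.
Proof.
move=> mW mY W0.
under eq_integral => x _.
  rewrite EFinM fimfunE -fsumEFin// ge0_mule_fsumr//; last first.
    by move=> r; exact: nnfun_muleindic_ge0.
  over.
rewrite ge0_integral_fsum//=.
- apply: eq_fsbigr => r /[!inE] -[y _ hyr].
  have r0 : 0 <= r by rewrite -hyr.
  have mYr : measurable (Y @^-1` (h @^-1` [set r])).
    by rewrite -[X in measurable X]setTI; exact: mY.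
  rewrite [in RHS]integral_mkcond -ge0_integralZl//; last 2 first.
  + apply/(measurable_restrictT _ mYr)/measurable_funTS.
    exact/measurable_EFinP.
  + by move=> x _; apply: erestrict_ge0 => ? _; rewrite lee_fin.
  apply: eq_integral => x _.
  rewrite patchE indicE EFinM muleCA; congr (_ * _)%E.
  have -> : (Y x \in h @^-1` [set r]) = (x \in Y @^-1` (h @^-1` [set r])).
    by apply/idP/idP; rewrite !inE.
  by case: ifP => _; rewrite ?mule1 ?mule0.
- move=> r; apply: emeasurable_funM; apply/measurable_EFinP => //.
  by apply: measurable_funM => //; apply: measurableT_comp.
- move=> r x _; apply: mule_ge0; first by rewrite lee_fin.
  exact: nnfun_muleindic_ge0.
Qed.

(** Two nonnegative weights with the same integrals over the events defined by
    [Y] cannot be told apart by nonnegative functions of [Y]: simple functions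
    of [Y] only see those events, and the general case follows by monotone
    convergence. *)
Lemma ge0_integral_weight_comp d d' (T : measurableType d)
    (T' : measurableType d') (R : realType) (mu : {measure set T -> \bar R})
    (W V : T -> R) (Y : T -> T') (f : T' -> R) :
  measurable_fun setT W -> measurable_fun setT V -> measurable_fun setT Y ->
  measurable_fun setT f ->
  (forall x, 0 <= W x) -> (forall x, 0 <= V x) -> (forall y, 0 <= f y) ->
  (forall B, measurable B ->
    \int[mu]_(x in Y @^-1` B) (W x)%:E = \int[mu]_(x in Y @^-1` B) (V x)%:E)%E ->
  (\int[mu]_x (W x * f (Y x))%:E = \int[mu]_x (V x * f (Y x))%:E)%E.
Proof.
move=> mW mV mY mf W0 V0 f0 WV.
have mEf : measurable_fun setT (EFin \o f) by exact/measurable_EFinP.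
pose h := nnsfun_approx measurableT mEf.
have lim (U : T -> R) : measurable_fun setT U -> (forall x, 0 <= U x) ->
    (\int[mu]_x (U x * f (Y x))%:E =
     limn (fun n => \int[mu]_x (U x * h n (Y x))%:E))%E.
  move=> mU U0; rewrite -monotone_convergence//.
  - apply: eq_integral => x _; apply/esym/cvg_lim => //.
    under eq_fun do rewrite EFinM.
    rewrite EFinM; apply: cvgeM => //; first exact: cvg_cst.
    by apply: (cvg_nnsfun_approx measurableT mEf) => // y _; rewrite lee_fin.
  - move=> n; apply/measurable_EFinP; apply: measurable_funM => //.
    exact: measurableT_comp.
  - by move=> n x _; rewrite lee_fin mulr_ge0.
  - move=> x _ m n mn; rewrite lee_fin ler_wpM2l//.
    exact/lefP/nd_nnsfun_approx.
rewrite !lim//; congr (limn _); apply/funext => n.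
rewrite !ge0_integral_weight_nnsfun//; apply: eq_fsbigr => r _.
by rewrite WV.
Qed.

Lemma bounded_integrable d (T : measurableType d) (R : realType)
    (mu : {finite_measure set T -> \bar R}) (A : set T) (f : T -> R) (M : R) :
  measurable A -> measurable_fun setT f -> (forall x, `|f x| <= M) ->
  mu.-integrable A (EFin \o f).
Proof.
move=> mA mf fM; apply: measurable_bounded_integrable => //.
- by rewrite ltey_eq fin_num_measure.
- exact: measurable_funTS.
- exists M; split; first exact: num_real.
  by move=> x Mx y _ /=; rewrite (le_trans (fM y))// ltW.
Qed.

(** The signed case reduces to [ge0_integral_weight_comp]: shifting [D] and [g]
    by their bounds makes them nonnegative, the weight [D + M] is compared with
    the constant weight [M], and the correction terms vanish because [D] has
    integral [0]. *)
Lemma Rintegral_weight_comp0 d d' (T : measurableType d)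
    (T' : measurableType d') (R : realType)
    (mu : {finite_measure set T -> \bar R})
    (D : T -> R) (Y : T -> T') (g : T' -> R) (M N : R) :
  measurable_fun setT D -> measurable_fun setT Y -> measurable_fun setT g ->
  (forall x, `|D x| <= M) -> (forall y, `|g y| <= N) ->
  (forall B, measurable B -> \int[mu]_(x in Y @^-1` B) D x = 0) ->
  \int[mu]_x (D x * g (Y x)) = 0.
Proof.
move=> mD mY mg DM gN DY0.
have geD (a b : R) : `|a| <= b -> 0 <= a + b.
  by rewrite ler_norml -lerBlDr sub0r => /andP[].
have M0 (x : T) : 0 <= M by exact: le_trans (DM x).
have N0 (x : T) : 0 <= N by exact: le_trans (gN (Y x)).
have mgY : measurable_fun setT (g \o Y) by exact: measurableT_comp.
have iD B : measurable B -> mu.-integrable B (EFin \o D).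
  by move=> mB; exact: bounded_integrable DM.
have iDg : mu.-integrable setT (EFin \o (fun x => D x * g (Y x))).
  apply: (@bounded_integrable _ _ _ _ _ _ (M * N)) => //.
    exact: measurable_funM.
  by move=> x; rewrite normrM ler_pM.
have ig : mu.-integrable setT (EFin \o (fun x => g (Y x))).
  by apply: (@bounded_integrable _ _ _ _ _ _ N).
have icst (r : R) B : measurable B -> mu.-integrable B (EFin \o (fun=> r)).
  by move=> mB; exact: (@bounded_integrable _ _ _ _ _ _ `|r|).
have iZ (r : R) (f : T -> R) : mu.-integrable setT (EFin \o f) ->
    mu.-integrable setT (EFin \o (fun x => r * f x)).
  by move=> If; apply: eq_integrable (integrableZl measurableT r If).
have iD0 (f1 f2 : T -> R) : mu.-integrable setT (EFin \o f1) ->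
    mu.-integrable setT (EFin \o f2) ->
    mu.-integrable setT (EFin \o (fun x => f1 x + f2 x)).
  by move=> If1 If2; apply: eq_integrable (integrableD measurableT If1 If2).
have : (\int[mu]_x ((D x + M) * (g (Y x) + N))%:E =
    \int[mu]_x (M * (g (Y x) + N))%:E)%E.
  apply: (@ge0_integral_weight_comp _ _ _ _ _ _ _ (fun=> M) _
    (fun y => g y + N)) => //.
  - exact: measurable_funD.
  - exact: measurable_funD.
  - by move=> x; exact: geD.
  - by move=> y; exact: geD.
  - move=> B mB.
    have mYB : measurable (Y @^-1` B).
      by rewrite -[X in measurable X]setTI; exact: mY.
    have := DY0 _ mB; rewrite /Rintegral => DB0.
    rewrite integralD_EFin//; last 2 first.
      exact: iD.
      exact: icst.
    rewrite -[X in (X + _)%E]fineK ?DB0 ?add0e//.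
    by apply: integrable_fin_num => //; exact: iD.
move=> /(congr1 fine); rewrite -!/(Rintegral _ _ _).
have -> : \int[mu]_x ((D x + M) * (g (Y x) + N)) =
    \int[mu]_x (D x * g (Y x)) + N * \int[mu]_x D x +
    \int[mu]_x (M * (g (Y x) + N)).
  rewrite -RintegralZl//; last exact: iD.
  rewrite -!RintegralD//.
  + apply: eq_Rintegral => x _; ring.
  + by apply: iD0; [exact: iDg|apply: iZ; exact: iD].
  + by apply: iZ; apply: iD0; [exact: ig|exact: icst].
  + by apply: iZ; exact: iD.
have -> : \int[mu]_x D x = 0 by have := DY0 _ measurableT; rewrite preimage_setT.
by rewrite mulr0 addr0 -[RHS]add0r => /addIr.
Qed.

(** If the signed measure [B |-> \int_(Y in B) W] is [k] times the image of
    [mu] under [Y], then both also agree on bounded functions of [Y]. *)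
Lemma Rintegral_weight_comp d d' (T : measurableType d)
    (T' : measurableType d') (R : realType)
    (mu : {finite_measure set T -> \bar R})
    (W : T -> R) (Y : T -> T') (g : T' -> R) (M N k : R) :
  measurable_fun setT W -> measurable_fun setT Y -> measurable_fun setT g ->
  (forall x, `|W x| <= M) -> (forall y, `|g y| <= N) ->
  (forall B, measurable B ->
    \int[mu]_(x in Y @^-1` B) W x = k * fine (mu (Y @^-1` B))) ->
  \int[mu]_x (W x * g (Y x)) = k * \int[mu]_x g (Y x).
Proof.
move=> mW mY mg WM gN WY.
have mgY : measurable_fun setT (g \o Y) by exact: measurableT_comp.
have ig : mu.-integrable setT (EFin \o (fun x => g (Y x))).
  by apply: (@bounded_integrable _ _ _ _ _ _ N).
have iZg : mu.-integrable setT (EFin \o (fun x => k * g (Y x))).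
  by apply: eq_integrable (integrableZl measurableT k ig).
have iWg : mu.-integrable setT (EFin \o (fun x => W x * g (Y x))).
  apply: (@bounded_integrable _ _ _ _ _ _ (M * N)) => //.
    exact: measurable_funM.
  by move=> x; rewrite normrM ler_pM.
apply/eqP; rewrite -subr_eq0 -RintegralZl// -RintegralB//; apply/eqP.
rewrite -[RHS](@Rintegral_weight_comp0 _ _ _ _ _ mu (fun x => W x - k) Y g
  (M + `|k|) N)//.
- by apply: eq_Rintegral => x _; rewrite mulrBl.
- exact: measurable_funB.
- by move=> x; rewrite (le_trans (ler_normB _ _))// lerD2r.
- move=> B mB.
  have mYB : measurable (Y @^-1` B).
    by rewrite -[X in measurable X]setTI; exact: mY.
  rewrite RintegralB// ?WY// ?Rintegral_cst ?subrr//.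
  + exact: bounded_integrable WM.
  + by apply: (@bounded_integrable _ _ _ _ _ _ `|k|).
Qed.

End weights.

(** * Characteristic function of a sum of independent variables *)

Section char_fun_sum.
Local Open Scope classical_set_scope.
Context d (T : measurableType d) (R : realType) (P : probability T R).
Context (I : finType) (X : I -> {RV P >-> R}).

Let event (B : I -> set R) : set T :=
  \bigcap_(i in [set` [set: I]%SET]) X i @^-1` B i.

Let measurable_event B : (forall i, measurable (B i)) -> measurable (event B).
Proof.
move=> mB; apply: fin_bigcap_measurable => // i _.
by rewrite -[X in measurable X]setTI; exact: measurable_funP.
Qed.

(** The formula for the characteristic function of the partial sum over [s],
    localized to an event that leaves the variables of [s] free.  The
    localization is what makes the induction on [s] work: adding [X k] to the
    sum uses the hypothesis for all events constraining [X k]. *)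
Lemma char_fun_sum_event (u : R) (s : seq I) (B : I -> set R) :
  mutually_independent X -> uniq s ->
  (forall i, measurable (B i)) -> {in s, forall i, B i = setT} ->
  let z := \prod_(i <- s) char_fun P (X i) u in
  (\int[P]_w (\1_(event B) w * cos (u * \sum_(i <- s) X i w)) =
    fine (P (event B)) * complex.Re z) /\
  (\int[P]_w (\1_(event B) w * sin (u * \sum_(i <- s) X i w)) =
    fine (P (event B)) * complex.Im z).
Proof.
move=> indep; elim: s B => [|k s IHs] B /=.
  move=> _ mB _; rewrite big_nil /= mulr1 mulr0; split.
  - under eq_Rintegral do rewrite big_nil mulr0 cos0 mulr1.
    by rewrite /Rintegral integral_indic ?setIT//; exact: measurable_event.
  - under eq_Rintegral do rewrite big_nil mulr0 sin0 mulr0.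
    by rewrite /Rintegral integral0.
move=> /andP[ks us] mB BT.
have [{}Bk {}BT] : B k = setT /\ {in s, forall i, B i = setT}.
  by split=> [|i si]; apply: BT; rewrite inE ?eqxx// si orbT.
have mev := measurable_event mB.
pose S w := \sum_(i <- s) X i w.
have mS : measurable_fun setT S by exact: measurable_sum.
have mX i : measurable_fun setT (X i) by exact: measurable_funP.
have muS (f : R -> R) (Z : T -> R) : continuous f -> measurable_fun setT Z ->
    measurable_fun setT (fun w => f (u * Z w)).
  move=> cf mZ; apply: measurableT_comp; first exact: continuous_measurable_fun.
  exact: measurable_funM.
have mu_ (f : R -> R) : continuous f -> measurable_fun setT (fun x => f (u * x)).
  move=> cf; apply: measurableT_comp; first exact: continuous_measurable_fun.
  exact: measurable_funM.
(* [upd C] adds the constraint [X k \in C] to the event given by [B]. *)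
pose upd C i := if i == k then C else B i.
have mupd C : measurable C -> forall i, measurable (upd C i).
  by move=> mC i; rewrite /upd; case: ifP.
have updT C : {in s, forall i, upd C i = setT}.
  move=> i si; rewrite /upd; case: eqP => [ik|_]; last exact: BT.
  by rewrite -ik si in ks.
have indic_upd C w :
    \1_(event (upd C)) w = ((\1_(event B) : T -> R) \_ (X k @^-1` C)) w :> R.
  have -> : event (upd C) = event B `&` X k @^-1` C.
    rewrite /event /upd; apply/seteqP; split=> [w' H|w' [H Cw] i _] /=.
      split=> [i _ /=|]; last by have := H k; rewrite /= eqxx; apply; rewrite inE.
      have := H i; case: (eqVneq i k) => [-> _|_]; first by rewrite Bk.
      by apply; rewrite /= inE.
    by case: eqP => [->//|_]; apply: H; rewrite /= inE.
  rewrite indicI patchE /=; case: ifP => Cw.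
    by rewrite [X in _ * X]indicE Cw mulr1.
  by rewrite [X in _ * X]indicE Cw mulr0.
have P_upd C : measurable C ->
    fine (P (event (upd C))) = fine (P (event B)) * fine (P (X k @^-1` C)).
  move=> mC.
  have mXC : measurable (X k @^-1` C).
    by rewrite -[X in measurable X]setTI; exact: measurable_funP.
  rewrite -fineM ?fin_num_measure//; congr fine.
  rewrite /event !indep//; last exact: mupd.
  rewrite (bigD1 k)//= [in RHS](bigD1 k)//= Bk preimage_setT probability_setT.
  rewrite mul1e muleC; congr (_ * _)%E; last by rewrite /upd eqxx.
  by apply: eq_bigr => i /andP[_ ik]; rewrite /upd (negbTE ik).
(* Integrating out [X k]; this serves for the four products of [cos] and [sin]
   that come out of the addition formulas. *)
have tower (f g : R -> R) (kappa : R) : continuous f -> continuous g ->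
    (forall x, `|f x| <= 1) -> (forall x, `|g x| <= 1) ->
    (forall C, measurable C -> \int[P]_w (\1_(event (upd C)) w * f (u * S w)) =
       fine (P (event (upd C))) * kappa) ->
    \int[P]_w (\1_(event B) w * f (u * S w) * g (u * X k w)) =
       fine (P (event B)) * kappa * \int[P]_w g (u * X k w).
  move=> cf cg f1 g1 HC.
  apply: (@Rintegral_weight_comp _ _ _ _ _ P (fun w => \1_(event B) w * f (u * S w))
    (X k) (fun x => g (u * x)) 1 1) => //.
  - by apply: measurable_funM => //; exact: muS.
  - exact: mu_.
  - move=> w; rewrite normrM -[leRHS]mulr1 ler_pM//.
    by rewrite indicE; case: (_ \in _); rewrite ?normr1 ?normr0.
  - move=> C mC; rewrite mulrAC -P_upd// -HC// Rintegral_mkcond.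
    apply: eq_Rintegral => w _; rewrite indic_upd !patchE; case: ifP => //.
    by rewrite mul0r.
have cos1 x : `|cos x| <= 1 :> R by rewrite ler_norml cos_geN1 cos_le1.
have sin1 x : `|sin x| <= 1 :> R by rewrite ler_norml sin_geN1 sin_le1.
have cc := @continuous_cos R; have cs := @continuous_sin R.
set z := \prod_(i <- s) _ in IHs *.
have charE : char_fun P (X k) u =
    ((\int[P]_w cos (u * X k w)) +i* (\int[P]_w sin (u * X k w)))%C.
  by rewrite /char_fun expectation.unlock.
have int (f g : R -> R) : continuous f -> continuous g ->
    (forall x, `|f x| <= 1) -> (forall x, `|g x| <= 1) ->
    P.-integrable setT (EFin \o
      (fun w => \1_(event B) w * f (u * S w) * g (u * X k w))).
  move=> cf cg f1 g1; apply: (@bounded_integrable _ _ _ _ _ _ 1) => //.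
    by do 2?[apply: measurable_funM => //]; exact: muS.
  move=> w; rewrite !normrM -[leRHS]mulr1 ler_pM// -[leRHS]mulr1 ler_pM//.
  by rewrite indicE; case: (_ \in _); rewrite ?normr1 ?normr0.
have IHc C (mC : measurable C) := (IHs (upd C) us (mupd _ mC) (updT C)).1.
have IHsn C (mC : measurable C) := (IHs (upd C) us (mupd _ mC) (updT C)).2.
rewrite big_cons -/z charE; case: z IHc IHsn {IHs} => a b /= IHc IHsn.
split.
- transitivity (\int[P]_w (\1_(event B) w * cos (u * S w) * cos (u * X k w)
     - \1_(event B) w * sin (u * S w) * sin (u * X k w))).
    apply: eq_Rintegral => w _; rewrite big_cons mulrDr cosD -/(S w). ring.
  rewrite RintegralB//; [|exact: int|exact: int].
  rewrite (tower cos cos a)// (tower sin sin b)//. ring.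
- transitivity (\int[P]_w (\1_(event B) w * cos (u * S w) * sin (u * X k w)
     + \1_(event B) w * sin (u * S w) * cos (u * X k w))).
    apply: eq_Rintegral => w _; rewrite big_cons mulrDr sinD -/(S w). ring.
  rewrite RintegralD//; [|exact: int|exact: int].
  rewrite (tower cos sin a)// (tower sin cos b)//. ring.
Qed.

Lemma char_fun_sum (u : R) : mutually_independent X ->
  char_fun P (fun w => \sum_i X i w) u = \prod_i char_fun P (X i) u.
Proof.
move=> indep.
have [] := @char_fun_sum_event u (index_enum I) (fun=> setT) indep
  (index_enum_uniq I) (fun=> measurableT) (fun _ _ => erefl).
have -> : event (fun=> setT) = setT by rewrite /event; apply/seteqP; split.
rewrite probability_setT /= !mul1r indicT.
under eq_Rintegral do rewrite mul1r.
under [in X in _ -> X -> _]eq_Rintegral do rewrite mul1r.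
rewrite [char_fun P (fun _ => _) u]/char_fun expectation.unlock.
rewrite -!/(Rintegral _ _ _).
by case: (\prod_i char_fun P (X i) u) => a b /= -> ->.
Qed.

End char_fun_sum.

(** * The density of the curvature integral *)

Section curvature_integrand.
Local Open Scope classical_set_scope.
Context {R : realType}.
Implicit Types c alpha u : R.

Lemma derive2_ln_stable c alpha u : 0 < u ->
  derive1n 2 (fun v : R => ln (complex.Re (stable_char_fun c alpha v))) u =
  - (c * (alpha * ((alpha - 1) * u `^ (alpha - 2)))).
Proof.
move=> u0.
have d1 v : 0 < v ->
    derive1 (fun v : R => ln (complex.Re (stable_char_fun c alpha v))) v =
    - (c * (alpha * v `^ (alpha - 1))).
  move=> v0.
  have vE : is_derive v 1 (fun w : R => - (c * w `^ alpha))
      (- (c * (alpha * v `^ (alpha - 1)))).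
    by have := is_derive1_powR alpha v0 => ?; apply: is_derive_eq.
  rewrite derive1E -[RHS](@derive_val _ _ _ _ _ _ _ vE).
  apply: near_eq_derive; near=> w; rewrite /stable_char_fun /= expRK.
  by rewrite gtr0_norm//; near: w; exact: lt_nbhsr.
have uE : is_derive u 1 (fun w : R => - (c * (alpha * w `^ (alpha - 1))))
    (- (c * (alpha * ((alpha - 1) * u `^ (alpha - 2))))).
  have -> : alpha - 2 = alpha - 1 - 1 by ring.
  by have := is_derive1_powR (alpha - 1) u0 => ?; apply: is_derive_eq.
(* The first derivative is only known on the positive half-line, which is
   a neighbourhood of [u]. *)
rewrite /derive1n /= derive1E -[RHS](@derive_val _ _ _ _ _ _ _ uE).
apply: near_eq_derive; near=> w; apply: d1.
by near: w; exact: lt_nbhsr.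
Unshelve. all: by end_near. Qed.

End curvature_integrand.

(** * Integrals over the positive half-line *)

Section half_line.
Local Open Scope classical_set_scope.

(** The fundamental theorem of calculus on the intervals [[1/(n+1), n+2]], which
    increase to the half-line.  Exhausting it from both ends at once allows [f]
    to be unbounded near [0]. *)
Lemma integral_derive_oy_le (R : realType) (f F : R -> R) (M : R) :
  (forall x : R, 0 < x -> 0 <= f x) ->
  (forall x : R, 0 < x -> {for x, continuous f}) ->
  (forall x : R, 0 < x -> is_derive x (1 : R) F (f x)) ->
  (forall x : R, 0 < x -> 0 <= F x <= M) ->
  (\int[lebesgue_measure]_(x in `]0%R, +oo[) (f x)%:E <= M%:E)%E.
Proof.
move=> f0 cf dF FM.
pose J n : set R := `[n.+1%:R^-1, n.+2%:R].
have Jgt0 n x : J n x -> 0 < x.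
  by rewrite /J/= in_itv/= => /andP[+ _]; apply: lt_le_trans.
have mJ n : measurable (J n : set R) by exact: measurable_itv.
have cJ n : {within J n, continuous f}.
  by apply: continuous_in_subspaceT => x /[!inE] /Jgt0; exact: cf.
have -> : `]0%R, +oo[%classic = \bigcup_n J n.
  apply/seteqP; split => [x|x [n _]]; last first.
    by move=> /Jgt0; rewrite /= in_itv/= andbT.
  rewrite /= in_itv/= andbT => x0.
  exists (maxn (Num.truncn x) (Num.truncn x^-1)) => //; rewrite /J/= in_itv/=.
  apply/andP; split.
    rewrite -[leRHS]invrK lef_pV2 ?posrE ?invr_gt0//.
    by rewrite (le_trans (ltW (truncnS_gt _)))// ler_nat ltnS leq_maxr.
  by rewrite (le_trans (ltW (truncnS_gt _)))// ler_nat ltnW// !ltnS leq_maxl.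
have ndJ : nondecreasing_seq J.
  move=> m n mn; rewrite /J; apply/subsetPset; apply: subset_itv.
    by rewrite bnd_simp lef_pV2 ?posrE// ler_nat.
  by rewrite bnd_simp ler_nat.
have mf n : measurable_fun (J n) (EFin \o f).
  apply/measurable_EFinP.
  by apply: subspace_continuous_measurable_fun.
have Ef0 n x : J n x -> (0 <= (EFin \o f) x)%E.
  by move=> /Jgt0 x0; rewrite lee_fin f0.
have /cvg_lim <- // := ge0_nondecreasing_set_cvg_integral
  (mu := @lebesgue_measure R) ndJ mJ mf Ef0.
apply: lime_le.
  apply: ereal_nondecreasing_is_cvgn.
  exact: ge0_nondecreasing_set_nondecreasing_integral.
apply: nearW => n.
have n0 : 0 < n.+1%:R^-1 :> R by rewrite invr_gt0.
have cF x : 0 < x -> {for x, continuous F}.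
  move=> x0; apply: differentiable_continuous; apply/derivable1_diffP.
  by case: (dF _ x0).
rewrite (@continuous_FTC2 _ f F)//.
- rewrite -EFinB lee_fin.
  have /andP[_ Fb] := FM n.+2%:R (ltr0Sn _ _).
  have /andP[Fa _] := FM _ n0.
  by rewrite lerBlDr (le_trans Fb)// lerDl.
- by rewrite (@le_lt_trans _ _ 1)// ?ltr1n// invf_le1// ler1n.
- exact: cJ.
- split.
  + move=> x; rewrite in_itv/= => /andP[nx _].
    by case: (dF _ (lt_trans n0 nx)).
  + by apply: cvg_at_right_filter; exact: cF.
  + by apply: cvg_at_left_filter; exact: cF.
- move=> x; rewrite in_itv/= => /andP[nx _].
  by rewrite derive1E; have [_ ->] := dF _ (lt_trans n0 nx).
Qed.

Lemma lebesgue_measure_scale (R : realType) (s : R) (s0 : 0 < s) (A : set R) :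
  measurable A ->
  lebesgue_measure (( *%R s) @^-1` A) = ((s^-1)%:E * lebesgue_measure A)%E.
Proof.
move=> mA.
have ms : measurable_fun setT ( *%R s : R -> R) by exact: measurable_funM.
have -> : lebesgue_measure A = pushforward
    (mscale (NngNum (ltW s0)) (@lebesgue_measure R))
    ( *%R s : _ -> measurableTypeR R) A.
  (* Both sides are measures, so half-open intervals suffice. *)
  apply: lebesgue_measure_unique => //= _ [[a b]] _ <-.
  rewrite /mscale /pushforward /=.
  have -> : *%R s @^-1` `]a, b] = `]a / s, b / s]%classic.
    apply/seteqP; split => x /=;
      by rewrite !in_itv/= ltr_pdivrMr// ler_pdivlMr// mulrC.
  rewrite !lebesgue_measure_itv/= !lte_fin ltr_pM2r ?invr_gt0//.
  case: ifP => _; rewrite ?mule0// -!EFinB -EFinM; congr EFin.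
  by rewrite -mulrBl mulrCA mulfV ?mulr1 ?gt_eqF.
by rewrite muleA -EFinM mulVf ?gt_eqF// mul1e.
Qed.

Lemma ge0_integral_oy_scale (R : realType) (s : R) (f : R -> R) :
  0 < s -> measurable_fun (`]0, +oo[ : set R) f ->
  (forall x : R, 0 < x -> 0 <= f x) ->
  (\int[lebesgue_measure]_(x in `]0%R, +oo[) (f (s * x)%R)%:E =
   (s^-1)%:E * \int[lebesgue_measure]_(x in `]0%R, +oo[) (f x)%:E)%E.
Proof.
move=> s0 mf f0.
have ms : measurable_fun setT ( *%R s : R -> R) by exact: measurable_funM.
have si : 0 <= s^-1 by rewrite invr_ge0 ltW.
transitivity (\int[pushforward lebesgue_measure
    ( *%R s : _ -> measurableTypeR R)]_(x in `]0%R, +oo[) (f x)%:E)%E.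
  rewrite ge0_integral_pushforward//; last 2 first.
  - exact/measurable_EFinP.
  - by move=> y; rewrite inE/= in_itv/= andbT lee_fin; exact: f0.
  congr (integral _ _ _).
  by apply/seteqP; split => x /=; rewrite !in_itv/= !andbT pmulr_rgt0.
rewrite -[s^-1]/((NngNum si)%:num) -ge0_integral_mscale//.
- apply: eq_measure_integral => //= A mA _.
  exact: lebesgue_measure_scale.
- exact/measurable_EFinP.
- by move=> x; rewrite /= in_itv/= andbT lee_fin; exact: f0.
Qed.

End half_line.

(** * Scaling and finiteness of the stable curvature *)

Section stable_curvature.
Local Open Scope classical_set_scope.
Context {R : realType}.
Implicit Types c alpha r u : R.

(** Equal to [- (ln phi)'' phi] for [phi] the characteristic function
    [e^{-c|u|^alpha}], on [u > 0]. *)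
Definition stable_curvature_density c alpha u : R :=
  c * (alpha * ((alpha - 1) * u `^ (alpha - 2))) * expR (- (c * u `^ alpha)).

Local Notation h := stable_curvature_density.
Local Notation mu := (@lebesgue_measure R).

Lemma PhiE c alpha : Phi c alpha =
  ((2 / Num.sqrt (2 * pi))%:E * \int[mu]_(u in `]0%R, +oo[) (h c alpha u)%:E)%E.
Proof.
apply: (congr1 (mule _)); apply: eq_integral => u; rewrite inE => u_gt0.
have u0 : 0 < u by move: u_gt0; rewrite /= in_itv/= andbT.
by rewrite (derive2_ln_stable _ _ u0) opprK /stable_char_fun/= gtr0_norm.
Qed.

Lemma stable_curvature_density_ge0 c alpha u :
  0 < c -> 1 <= alpha -> 0 <= h c alpha u.
Proof.
move=> c0 a1; rewrite mulr_ge0 ?expR_ge0// mulr_ge0 ?(ltW c0)// mulr_ge0//.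
  by rewrite (le_trans _ a1).
by rewrite mulr_ge0 ?powR_ge0// subr_ge0.
Qed.

Lemma measurable_stable_curvature_density c alpha (D : set R) :
  measurable_fun D (h c alpha).
Proof.
apply: measurable_funTS; apply: measurable_funM.
  by do 3 apply: measurable_funM => //; exact: measurable_powR.
apply: measurableT_comp => //; apply: measurableT_comp => //.
by apply: measurable_funM => //; exact: measurable_powR.
Qed.

Lemma stable_curvature_density_scale c alpha r u :
  0 < alpha -> 0 < r -> 0 < u ->
  h (r * c) alpha u = (r `^ (1 / alpha)) ^+ 2 * h c alpha (r `^ (1 / alpha) * u).
Proof.
move=> a0 r0 u0; set s := r `^ (1 / alpha).
have s0 : 0 < s by exact: powR_gt0.
have sa : s `^ alpha = r.
  by rewrite /s -powRrM div1r mulVf ?gt_eqF// powRr1// ltW.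
have s2 : s ^+ 2 * s `^ (alpha - 2) = r.
  rewrite -powR_mulrn ?ltW// -powRD; last by apply/implyP => _; rewrite gt_eqF.
  by rewrite addrC subrK.
rewrite /h !powRM ?ltW// sa.
rewrite -{1}s2; have -> : c * (r * u `^ alpha) = r * c * u `^ alpha by ring.
ring.
Qed.

(** The density gains the factor [s^2] with [s = r^(1/alpha)], and the
    substitution [v = s u] gives back [1/s]. *)
Lemma Phi_scale c alpha r : 0 < c -> 1 <= alpha -> 0 < r ->
  Phi (r * c) alpha = (Phi c alpha * (r `^ (1 / alpha))%:E)%E.
Proof.
move=> c0 a1 r0; rewrite !PhiE -muleA; apply: (congr1 (mule _)).
set s := r `^ (1 / alpha).
have s0 : 0 < s by exact: powR_gt0.
transitivity (\int[mu]_(u in `]0%R, +oo[) ((s ^+ 2)%:E * (h c alpha (s * u))%:E))%E.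
  apply: eq_integral => u; rewrite inE/= in_itv/= andbT => u0.
  by rewrite stable_curvature_density_scale// (lt_le_trans ltr01).
rewrite ge0_integralZl//; last 3 first.
- apply/measurable_EFinP; apply: measurable_funTS.
  apply: measurableT_comp; first exact: measurable_stable_curvature_density.
  exact: measurable_funM.
- by move=> u _; rewrite lee_fin stable_curvature_density_ge0.
- by rewrite lee_fin sqr_ge0.
rewrite ge0_integral_oy_scale//; last 2 first.
- exact: measurable_stable_curvature_density.
- by move=> u _; exact: stable_curvature_density_ge0.
rewrite muleA -EFinM muleC; apply: (congr1 (fun x => _ * x%:E)%E).
by rewrite expr2 mulfK ?gt_eqF.
Qed.

(** The exponent is halved so that the square of this inequality absorbs the
    factor [e^{-c u^alpha}] of the density.  It follows from
    [u^(alpha - 1) <= 1 + u^alpha] and [1 + x <= e^x]. *)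
Lemma powRB1_le_expR c alpha u : 0 < c -> 1 <= alpha -> 0 < u ->
  1 + u `^ (alpha - 1) <= (2 + 2 / c) * expR (c * u `^ alpha / 2).
Proof.
move=> c0 a1 u0; set x := u `^ alpha.
have x0 : 0 <= x by exact: powR_ge0.
have ux : u `^ (alpha - 1) <= 1 + x.
  have [u1|/ltW u1] := leP u 1.
    rewrite (@le_trans _ _ 1)// ?lerDl//.
    apply: (@le_trans _ _ (1 `^ (alpha - 1))); last by rewrite powR1.
    by apply: ge0_ler_powR; rewrite ?nnegrE ?subr_ge0// ltW.
  by rewrite (@le_trans _ _ x)// ?lerDr// ler_powR// lerBlDr lerDl.
apply: (@le_trans _ _ ((2 + 2 / c) * (1 + c * x / 2))); last first.
  by rewrite ler_wpM2l ?expR_ge1Dx// addr_ge0// divr_ge0// ltW.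
have -> : (2 + 2 / c) * (1 + c * x / 2) = 2 + x + (2 / c + c * x).
  by field; rewrite gt_eqF.
have : 0 <= 2 / c + c * x by rewrite addr_ge0 ?divr_ge0 ?mulr_ge0// ltW.
by move: ux; lra.
Qed.

(** The last factor is the derivative of [1 - 1 / (1 + u^(alpha - 1))], which
    takes values in [[0, 1]]; this is what makes the density integrable, and
    for [alpha = 1] both sides vanish. *)
Lemma stable_curvature_density_le c alpha u : 0 < c -> 1 <= alpha -> 0 < u ->
  h c alpha u <= c * alpha * (2 + 2 / c) ^+ 2 *
    ((alpha - 1) * u `^ (alpha - 2) / (1 + u `^ (alpha - 1)) ^+ 2).
Proof.
move=> c0 a1 u0; set y := 1 + u `^ (alpha - 1); set k := 2 + 2 / c.
set E := expR (c * u `^ alpha / 2).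
have y0 : 0 < y by rewrite ltr_wpDr ?powR_ge0.
have hE : expR (- (c * u `^ alpha)) = (E ^+ 2)^-1.
  by rewrite expRN /E -expRM_natl [2 * _]mulrC divfK.
have Ek : (E ^+ 2)^-1 <= k ^+ 2 / y ^+ 2.
  rewrite ler_pdivlMr ?exprn_gt0// mulrC ler_pdivrMr ?exprn_gt0 ?expR_gt0//.
  rewrite -exprMn lerXn2r ?nnegrE ?powRB1_le_expR//; first exact: ltW.
  by rewrite mulr_ge0 ?expR_ge0// addr_ge0// divr_ge0// ltW.
rewrite /h hE.
have -> : c * alpha * k ^+ 2 * ((alpha - 1) * u `^ (alpha - 2) / y ^+ 2) =
  c * (alpha * ((alpha - 1) * u `^ (alpha - 2))) * (k ^+ 2 / y ^+ 2) by ring.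
rewrite ler_wpM2l// mulr_ge0 ?(ltW c0)// mulr_ge0 ?(le_trans _ a1)//.
by rewrite mulr_ge0 ?powR_ge0// subr_ge0.
Qed.

Lemma Phi_fin_num c alpha : 0 < c -> 1 <= alpha -> Phi c alpha \is a fin_num.
Proof.
move=> c0 a1; rewrite PhiE fin_numM//.
set K := c * alpha * (2 + 2 / c) ^+ 2.
have K0 : 0 <= K by rewrite mulr_ge0 ?sqr_ge0// mulr_ge0 ?(ltW c0) ?(le_trans _ a1).
pose F u := K * (1 - (1 + u `^ (alpha - 1))^-1).
pose f u := K * ((alpha - 1) * u `^ (alpha - 2) / (1 + u `^ (alpha - 1)) ^+ 2).
have y1 u : 1 <= 1 + u `^ (alpha - 1) by rewrite lerDl powR_ge0.
have y0 u : 0 < 1 + u `^ (alpha - 1) by rewrite (lt_le_trans ltr01).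
have dy u : 0 < u -> is_derive u 1 (fun v => 1 + v `^ (alpha - 1))
    ((alpha - 1) * u `^ (alpha - 2)).
  move=> u0; have -> : alpha - 2 = alpha - 1 - 1 by ring.
  have := is_derive1_powR (alpha - 1) u0 => ?.
  by apply: is_derive_eq; ring.
have cpow a u : 0 < u -> {for u, continuous (fun v => v `^ a)}.
  move=> u0; apply: differentiable_continuous; apply/derivable1_diffP.
  by case: (is_derive1_powR a u0).
have cf u : 0 < u -> {for u, continuous f}.
  move=> u0; apply: continuousM; first exact: cvg_cst.
  apply: continuousM; first by apply: continuousM; [exact: cvg_cst|exact: cpow].
  have cy : {for u, continuous (fun v => 1 + v `^ (alpha - 1))}.
    by apply: continuousD; [exact: cvg_cst|exact: cpow].
  apply: continuousV; first by rewrite expf_neq0// gt_eqF.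
  exact: continuousM.
have fle : (\int[mu]_(u in `]0%R, +oo[) (f u)%:E <= K%:E)%E.
  apply: (@integral_derive_oy_le _ f F).
  - move=> u u0; rewrite mulr_ge0// divr_ge0 ?sqr_ge0// mulr_ge0 ?powR_ge0//.
    by rewrite subr_ge0.
  - exact: cf.
  - move=> u u0; have yn0 := lt0r_neq0 (y0 u).
    have := @is_deriveV _ (fun v => 1 + v `^ (alpha - 1)) _ _ _ yn0 (dy u u0) => ?.
    by apply: is_derive_eq; rewrite /f /GRing.scale /=; field.
  - move=> u u0; rewrite /F; apply/andP; split.
      by rewrite mulr_ge0// subr_ge0 invf_le1.
    by rewrite ler_piMr// lerBlDr lerDl invr_ge0 ltW.
have h0 : (0 <= \int[mu]_(u in `]0%R, +oo[) (h c alpha u)%:E)%E.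
  by apply: integral_ge0 => u _; rewrite lee_fin stable_curvature_density_ge0.
rewrite ge0_fin_numE//; apply: (le_lt_trans _ (ltry K)).
apply: le_trans fle; apply: ge0_le_integral => //.
- by move=> u _; rewrite lee_fin stable_curvature_density_ge0.
- by apply/measurable_EFinP; exact: measurable_stable_curvature_density.
- apply/measurable_EFinP; apply: open_continuous_measurable_fun => //.
  by move=> u; rewrite inE/= in_itv/= andbT => u0; exact: cf.
- move=> u; rewrite /= in_itv/= andbT => u0.
  by rewrite lee_fin stable_curvature_density_le.
Qed.

End stable_curvature.

(** * Curvature of a sum of stable variables *)

Theorem mainTheorem3 (R : realType) (d : measure_display)
    (T : measurableType d) (P : probability T R)
    (c alpha : R) (t : nat) (X : 'I_t -> {RV P >-> R})
    (hc : 0 < c) (halpha : 1 <= alpha <= 2) (ht : (1 <= t)%N)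
    (hindep : mutually_independent X)
    (hid : identically_distributed X)
    (hstable : forall (i : 'I_t) (u : R),
       char_fun P (X i) u = stable_char_fun c alpha u) :
  let S : T -> R := fun w => \sum_(i < t) X i w in
  [/\ forall u : R, char_fun P S u = stable_char_fun (t%:R * c) alpha u,
      char_curvature (char_fun P S) = Phi (t%:R * c) alpha,
      Phi c alpha \is a fin_num
    & Phi (t%:R * c) alpha = (Phi c alpha * (t%:R `^ (1 / alpha))%:E)%E].
Proof.
move=> S.
have a1 : 1 <= alpha by case/andP: halpha.
have t0 : 0 < t%:R :> R by rewrite ltr0n.
have charS u : char_fun P S u = stable_char_fun (t%:R * c) alpha u.
  rewrite (char_fun_sum u hindep) (eq_bigr _ (fun i _ => hstable i u)).
  rewrite prodr_const card_ord /stable_char_fun -rmorphXn /= -expRM_natl.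
  by rewrite mulrN mulrA.
split.
- exact: charS.
- by rewrite /Phi; congr char_curvature; apply/funext.
- exact: Phi_fin_num.
- exact: Phi_scale.
Qed.
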